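(* An $n$-PCM, $n\ge 0$, which is a simplicial complex is not necessarily a smooth $n$-PCM; that is, there exist an integer $n\ge0$ and a simplicial complex $X$ such that $X$ is an $n$-PCM but $X$ is not a smooth $n$-PCM.
   Context: Posets. For a poset $X$ with order $\le$ and $h\in X$, put $\alpha_X(h)=\{h'\in X: h'\le h\}$, $\beta_X(h)=\{h'\in X: h'\ge h\}$, $\theta_X(h)=\alpha_X(h)\cup\beta_X(h)$, and let $\alpha^{\square}_X(h),\beta^{\square}_X(h),\theta^{\square}_X(h)$ be these sets with $h$ removed. Any subset $S\subseteq X$ is regarded as a poset $|S|$ with the induced order. The rank $\mathrm{rk}(h,X)$ is $0$ if $\alpha^{\square}_X(h)=\emptyset$ and $1+\max_{x\in\alpha^{\square}_X(h)}\mathrm{rk}(x,X)$ otherwise; the rank of $X$ is the maximal rank of its elements, and $-1$ if $X=\emptyset$. A path is a finite sequence $\langle p^0,\dots,p^k\rangle$ in $X$ with $p^i\in\theta^{\square}_X(p^{i-1})$ for $1\le i\le k$; $X$ is connected if any two elements are joined by a path in $X$. Discrete surfaces. A CF-order is a countable poset with all $\theta_X(h)$ finite. A CF-order $X$ is a (discrete) $(-1)$-surface if $X=\emptyset$; a $0$-surface if $X=\{x,y\}$ with $x\neq y$ and $x\notin\theta^{\square}_X(y)$; and, for $k\ge1$, a $k$-surface if it is non-empty, connected and $|\theta^{\square}_X(h)|$ is a $(k-1)$-surface for every $h\in X$. Border and PCM's. The border of a poset $X$ of rank $n\ge0$ is $\Delta X=\{h\in X: |\theta^{\square}_X(h)|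 \text{ is not an } (n-1)\text{-surface}\}$. A poset $X$ of rank $n$ is an $n$-PCM if: $n=-1$ and $X=\emptyset$; or $n=0$ and $X$ is a singleton; or $n\ge1$, $X$ is connected, $\Delta X\ne\emptyset$, and for every $h\in X$, $|\theta^{\square}_X(h)|$ is either an $(n-1)$-surface or an $(n-1)$-PCM. Smooth PCM's. A separated union of posets is a union of pairwise disjoint posets in which no element of one is comparable to an element of another. A poset $X$ of rank $n$ is a smooth $n$-PCM if: $n=-1$ and $X=\emptyset$; or $n=0$ and $X$ is a singleton; or $n\ge1$, $X$ is connected, its border $\Delta X\neq\emptyset$ is a discrete $(n-1)$-surface or a separated union of discrete $(n-1)$-surfaces, and for every $h\in X$, $|\theta^{\square}_X(h)|$ is either a smooth $(n-1)$-PCM (when $h\in\Delta X$) or an $(n-1)$-surface (when $h\notin\Delta X$). Simplicial complexes. A simplex is a non-empty finite set $h$, of dimension $\#h-1$. A simplicial complex is a set of simplices containing every non-empty subset of each of its elements; it is viewed as a poset ordered by inclusion. *)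

(* Defs.v *)
From HB Require Import structures.
From mathcomp Require Import all_boot all_order all_algebra.
From mathcomp Require Import finmap.
From mathcomp Require Import boolp classical_sets functions cardinality.

Set Implicit Arguments.
Unset Strict Implicit.
Unset Printing Implicit Defensive.

Import Order.TTheory GRing.Theory Num.Theory.

Local Open Scope classical_set_scope.
Local Open Scope ring_scope.

(* A poset |X| is given as a subset X of an ambient porderType T, with the
   induced order; a subset of a poset X is then again a [set T]. *)

Definition alpha d (T : porderType d) (X : set T) (h : T) : set T :=
  [set x | X x /\ (x <= h)%O].

Definition beta d (T : porderType d) (X : set T) (h : T) : set T :=
  [set x | X x /\ (h <= x)%O].

Definition theta d (T : porderType d) (X : set T) (h : T) : set T :=
  alpha X h `|` beta X h.

(* The suffix "sq" stands for the superscript square: h itself is removed. *)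
Definition alphasq d (T : porderType d) (X : set T) (h : T) : set T :=
  alpha X h `\ h.

Definition thetasq d (T : porderType d) (X : set T) (h : T) : set T :=
  theta X h `\ h.

(* [rk X h n] means rk(h, X) = n. It is a relation because an element of an
   arbitrary poset need not have a rank; in [rk_max] the maximum of the ranks
   of the elements of alphasq X h exists and is equal to n. *)
Inductive rk d (T : porderType d) (X : set T) : T -> nat -> Prop :=
| rk_min h : alphasq X h = set0 -> rk X h 0
| rk_max h n :
    (forall x, alphasq X h x -> exists2 m, (m <= n)%N & rk X x m) ->
    (exists2 x, alphasq X h x & rk X x n) ->
    rk X h n.+1.

(* [rank X n] means that X has rank n. *)
Definition rank d (T : porderType d) (X : set T) (n : int) : Prop :=
  (X = set0 /\ n = -1) \/
  (exists2 m : nat, n = m%:Z &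
     (exists2 h, X h & rk X h m) /\
     (forall h, X h -> exists2 k, (k <= m)%N & rk X h k)).

(* The sequence x :: p is a path from x to y. *)
Definition poset_connected d (T : porderType d) (X : set T) : Prop :=
  forall x y, X x -> X y ->
    exists2 p : seq T, path [rel a b | b \in thetasq X a] x p & last x p = y.

Definition CF_order d (T : porderType d) (X : set T) : Prop :=
  countable X /\ forall h, X h -> finite_set (theta X h).

Inductive surface d (T : porderType d) : int -> set T -> Prop :=
| surfaceN1 (X : set T) : CF_order X -> X = set0 -> surface (-1) X
| surface0 (X : set T) (x y : T) :
    CF_order X -> X = [set x; y] -> x <> y -> ~ thetasq X y x -> surface 0 X
| surfaceS (k : int) (X : set T) :
    1 <= k -> CF_order X -> X !=set0 -> poset_connected X ->
    (forall h, X h -> surface (k - 1) (thetasq X h)) ->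
    surface k X.

(* The border Delta X of a poset X, where n is meant to be the rank of X. *)
Definition border d (T : porderType d) (n : int) (X : set T) : set T :=
  [set h | X h /\ ~ surface (n - 1) (thetasq X h)].

Inductive PCM d (T : porderType d) : int -> set T -> Prop :=
| PCM_N1 (X : set T) : rank X (-1) -> X = set0 -> PCM (-1) X
| PCM_0 (X : set T) (x : T) : rank X 0 -> X = [set x] -> PCM 0 X
| PCM_S (n : int) (X : set T) :
    1 <= n -> rank X n -> poset_connected X -> border n X !=set0 ->
    (forall h, X h ->
       surface (n - 1) (thetasq X h) \/ PCM (n - 1) (thetasq X h)) ->
    PCM n X.

Definition separated_union_of d (T : porderType d) (P : set T -> Prop)
    (X : set T) : Prop :=
  exists F : set (set T),
    [/\ X = \bigcup_(A in F) A,
        forall A, F A -> P A,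
        trivIset F id &
        forall A B, F A -> F B -> A <> B ->
          forall a b, A a -> B b -> ~~ (a >=< b)%O].

Inductive smooth_PCM d (T : porderType d) : int -> set T -> Prop :=
| smooth_PCM_N1 (X : set T) : rank X (-1) -> X = set0 -> smooth_PCM (-1) X
| smooth_PCM_0 (X : set T) (x : T) :
    rank X 0 -> X = [set x] -> smooth_PCM 0 X
| smooth_PCM_S (n : int) (X : set T) :
    1 <= n -> rank X n -> poset_connected X -> border n X !=set0 ->
    (surface (n - 1) (border n X) \/
     separated_union_of (surface (n - 1)) (border n X)) ->
    (forall h, border n X h -> smooth_PCM (n - 1) (thetasq X h)) ->
    (forall h, X h -> ~ border n X h -> surface (n - 1) (thetasq X h)) ->
    smooth_PCM n X.

Fact fset_display : Order.disp_t. Proof. exact: Order.Disp tt tt. Qed.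

Fact fsubset_anti (V : choiceType) : antisymmetric (@fsubset V).
Proof. by move=> A B; rewrite -eqEfsubset => /eqP. Qed.

Fact fsubset_transitive (V : choiceType) : transitive (@fsubset V).
Proof. by move=> B A C; apply: fsubset_trans. Qed.

(* Finite sets are ordered by inclusion. *)
HB.instance Definition _ (V : choiceType) :=
  Order.Le_isPOrder.Build fset_display {fset V}
    (@fsubset_refl V) (@fsubset_anti V) (@fsubset_transitive V).

Definition simplicial_complex (V : choiceType) (X : set {fset V}) : Prop :=
  (forall h, X h -> h != fset0) /\
  (forall h g : {fset V}, X h -> g != fset0 -> fsubset g h -> X g).

(* Main.v *)
Require Import Defs.
From mathcomp Require Import all_boot all_order all_algebra.
From mathcomp Require Import finmap classical_sets.
From mathcomp Require Import functions cardinality zify.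

(** The counterexample is the ray: the simplicial complex on the natural
    numbers whose edges are the pairs {k, k+1}.

    List its simplices along the ray as {0}, {0,1}, {1}, {1,2}, ... Two distinct
    simplices are comparable exactly when they are consecutive in this list
    ([thetasq_cell0], [thetasq_cellS]). So the link of the first one is a
    singleton, a 0-PCM, and every other link consists of two incomparable
    elements, a 0-surface. The ray is connected of rank 1, hence a 1-PCM, and
    its border is the single end {0} ([border_ray]). A 0-surface has exactly two
    elements, so a singleton is neither a 0-surface nor a union of 0-surfaces
    ([surface0_not_sub1]): the ray is not smooth. A finite path with
    at least one edge would be smooth, as its two ends form a 0-surface; the
    ray sends one of them to infinity. *)

Set Implicit Arguments.
Unset Strict Implicit.
Unset Printing Implicit Defensive.

Import Order.TTheory GRing.Theory.

Local Open Scope fset_scope.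
Local Open Scope classical_set_scope.

(** The simplices in their order along the ray: [cell k.*2] is the vertex {k}
    and [cell k.*2.+1] the edge {k, k+1}. *)
Definition cell (i : nat) : {fset nat} := [fset i./2; uphalf i].

Definition ray : set {fset nat} := range cell.

(** Besides the simplex itself, only an edge (odd index) has faces: the vertices
    just before and just after it. *)
Lemma le_cell i j :
  (cell i <= cell j)%O = (i == j) || odd j && ((i == j.+1) || (j == i.+1)).
Proof.
have -> : (cell i <= cell j)%O = fsubset (cell i) (cell j) by [].
rewrite /cell fsubUset !fsub1set !inE !uphalf_half.
have := odd_double_half j; have := odd_double_half i.
(* Write i and j as their parities plus twice their halves, so that only linear
   arithmetic in the halves remains. *)
by move: (odd i) (odd j) i./2 j./2 => [] [] a b /= <- <-; lia.
Qed.

Lemma cell_inj : injective cell.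
Proof.
move=> i j eij.
have := le_cell i j; have := le_cell j i; rewrite eij lexx.
lia.
Qed.

Lemma ray_simplicial : simplicial_complex ray.
Proof.
split=> [_ [i _ <-]|_ g [i _ <-] g0 /fsubsetP gi].
  by apply/fset0Pn; exists i./2; rewrite !inE eqxx.
have gE x : x \in g -> x = i./2 \/ x = uphalf i.
  by move=> /gi; rewrite !inE => /orP[] /eqP; [left|right].
have [ag|ag] := boolP (i./2 \in g); have [bg|bg] := boolP (uphalf i \in g).
(* The face g is determined by which of the two end points it contains; if
   only one, g is a vertex, whose index is even. *)
- exists i => //; apply/fsetP => x; rewrite !inE; apply/idP/idP => [|/gE[]->].
  + by case/orP=> /eqP->.
  + by rewrite eqxx.
  + by rewrite eqxx orbT.
- exists i./2.*2 => //; apply/fsetP => x; rewrite !inE.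
  rewrite doubleK uphalf_double orbb.
  apply/eqP/idP => [->//|xg]; case: (gE _ xg) => // xE.
  by rewrite -xE xg in bg.
- exists (uphalf i).*2 => //; apply/fsetP => x; rewrite !inE.
  rewrite doubleK uphalf_double orbb.
  apply/eqP/idP => [->//|xg]; case: (gE _ xg) => // xE.
  by rewrite -xE xg in ag.
- have /fset0Pn[x xg] := g0.
  by case: (gE _ xg) => xE; rewrite -xE xg in ag bg.
Qed.

Lemma thetasq_cell i j :
  thetasq ray (cell i) (cell j) <-> j = i.+1 \/ i = j.+1.
Proof.
have rj : ray (cell j) by exists j.
split=> [[[] [_ /= le] ne]|ij].
- have {}ne : j <> i by move=> ji; apply: ne; rewrite ji.
  by move: le; rewrite le_cell; lia.
- have {}ne : j <> i by move=> ji; apply: ne; rewrite ji.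
  by move: le; rewrite le_cell; lia.
split; last by move=> /= /cell_inj; lia.
have : (cell j <= cell i)%O || (cell i <= cell j)%O by rewrite !le_cell; lia.
by case/orP=> le; [left|right].
Qed.

Lemma thetasq_ray i x : thetasq ray (cell i) x -> ray x.
Proof. by case=> -[[]|[]]. Qed.

Lemma thetasq_cell0 : thetasq ray (cell 0) = [set cell 1].
Proof.
apply/seteqP; split=> [x xt|_ ->]; last by apply/thetasq_cell; left.
have [j _ jx] := thetasq_ray xt.
by move: xt; rewrite -jx => /thetasq_cell [->|].
Qed.

Lemma thetasq_cellS i :
  thetasq ray (cell i.+1) = [set cell i; cell i.+2].
Proof.
apply/seteqP; split=> [x xt|_ [] ->]; last 2 first.
- by apply/thetasq_cell; right.
- by apply/thetasq_cell; left.
have [j _ jx] := thetasq_ray xt.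
by move: xt; rewrite -jx => /thetasq_cell [->|[->]]; [right|left].
Qed.

Lemma ray_connected : poset_connected ray.
Proof.
pose step := [rel a b | b \in thetasq ray a].
have up i n :
    exists2 p, path step (cell i) p & last (cell i) p = cell (i + n).
  elim: n i => [|n IH] i; first by exists [::]; rewrite // addn0.
  have [p pp pl] := IH i.+1.
  exists (cell i.+1 :: p); last by rewrite /= pl addSnnS.
  by rewrite /= pp andbT; apply/mem_set/thetasq_cell; left.
have down i n :
    exists2 p, path step (cell (i + n)) p & last (cell (i + n)) p = cell i.
  elim: n => [|n [p pp pl]]; first by exists [::]; rewrite // addn0.
  exists (cell (i + n) :: p); last by rewrite /= pl.
  by rewrite /= pp andbT; apply/mem_set/thetasq_cell; right; rewrite addnS.
move=> _ _ [i _ <-] [j _ <-].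
have [ij|/ltnW ji] := leqP i j.
  by have := up i (j - i); rewrite subnKC.
by have := down j (i - j); rewrite subnKC.
Qed.

Lemma rk_cell i : rk ray (cell i) (odd i).
Proof.
have rk_even k : ~~ odd k -> rk ray (cell k) 0.
  move=> k_even; apply: rk_min; apply/seteqP; split=> // x.
  move=> [[[j _ <-] /= le] ne].
  have {}ne : j <> k by move=> jk; apply: ne; rewrite jk.
  by move: le; rewrite le_cell; lia.
case: (boolP (odd i)) => [i_odd|/rk_even//]; apply: rk_max.
  move=> x [[[j _ <-] /= le] ne]; exists 0 => //; apply: rk_even.
  have {}ne : j <> i by move=> ji; apply: ne; rewrite ji.
  by move: le; rewrite le_cell; lia.
exists (cell i.+1); last by apply: rk_even; rewrite /= i_odd.
split; last by move=> /= /cell_inj; lia.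
by split; [exists i.+1 | rewrite /= le_cell; lia].
Qed.

Lemma rank_ray : rank ray 1%R.
Proof.
right; exists 1 => //; split.
  by exists (cell 1); [exists 1 | exact: (rk_cell 1)].
by move=> _ [i _ <-]; exists (odd i); [case: odd | exact: rk_cell].
Qed.

Lemma rank_set1 d (T : porderType d) (x : T) : rank [set x] 0%R.
Proof.
have rk0 : rk [set x] x 0.
  by apply: rk_min; apply/seteqP; split=> // y [[/= ->]].
right; exists 0 => //; split; first by exists x.
by move=> _ ->; exists 0.
Qed.

Lemma finite_CF_order d (T : porderType d) (X : set T) :
  finite_set X -> CF_order X.
Proof.
move=> finX; split=> [|h _]; first exact: finite_set_countable.
by apply: sub_finite_set finX => x [[]|[]].
Qed.

Lemma surface0_thetasq_cellS i : surface 0%R (thetasq ray (cell i.+1)).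
Proof.
rewrite thetasq_cellS; apply: (@surface0 _ _ _ (cell i) (cell i.+2)) => //.
- by apply: finite_CF_order; rewrite finite_setU; split; exact: finite_set1.
- by move=> /cell_inj; lia.
- by case=> -[] [_ /=]; rewrite le_cell; lia.
Qed.

(** The two elements of a 0-surface are distinct, so they do not fit in a
    singleton; this obstructs both alternatives for a smooth border. *)
Lemma surface0_not_sub1 d (T : porderType d) (X : set T) (x : T) :
  surface 0%R X -> ~ X `<=` [set x].
Proof.
move E : 0%R => n surfX.
case: surfX E => {n X} [X _ _ /eqP|X y z _ -> yz _ _ sub|].
- by [].
- by apply: yz; rewrite (sub y); [rewrite (sub z)//; right|left].
- by move=> k X k1 _ _ _ _ k0; rewrite -k0 in k1.
Qed.

Lemma border_ray : border 1%R ray = [set cell 0].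
Proof.
apply/seteqP; split=> [_ [[[|i] _ <-] ns]//|_ ->].
  by case: ns; exact: surface0_thetasq_cellS.
split; first by exists 0.
by rewrite thetasq_cell0 => /(@surface0_not_sub1 _ _ _ (cell 1)); apply.
Qed.

Lemma PCM_ray : PCM 1%R ray.
Proof.
apply: PCM_S => //.
- exact: rank_ray.
- exact: ray_connected.
- by exists (cell 0); rewrite border_ray.
move=> _ [[|i] _ <-]; last by left; exact: surface0_thetasq_cellS.
by right; rewrite thetasq_cell0; apply: PCM_0 => //; exact: rank_set1.
Qed.

Lemma smooth_PCM1_border d (T : porderType d) (X : set T) :
  smooth_PCM 1%R X ->
  surface 0%R (border 1%R X) \/
  separated_union_of (surface 0%R) (border 1%R X).
Proof.
move E : 1%R => n smX.
case: smX E => {n X} [X _ _ /eqP //|X x _ _ /eqP //|n X _ _ _ _ bX _ _ n1].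
by move: bX; rewrite -n1 subrr.
Qed.

Lemma not_smooth_PCM_ray : ~ smooth_PCM 1%R ray.
Proof.
move=> /smooth_PCM1_border; rewrite border_ray.
case=> [/(@surface0_not_sub1 _ _ _ (cell 0))|]; first by apply.
move=> [F [XE surfF _ _]].
have [A FA _] : (\bigcup_(A in F) A) (cell 0) by rewrite -XE.
apply: (@surface0_not_sub1 _ _ _ (cell 0) (surfF _ FA)).
by rewrite XE => y Ay; exists A.
Qed.

Theorem theorem4 :
  exists (n : int) (V : choiceType) (X : set {fset V}),
    [/\ (0 <= n)%R, simplicial_complex X, PCM n X & ~ smooth_PCM n X].
Proof.
exists 1%R, nat, ray; split=> //.
- exact: ray_simplicial.
- exact: PCM_ray.
- exact: not_smooth_PCM_ray.
Qed.
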